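(* Let $\Theta$ and $\mathcal{Z}$ be measurable spaces, let $S$ be a random element of $\mathcal{Z}$, and let $\Delta:\Theta\times\mathcal{Z}\to\mathbb{R}$ and $V:\Theta\times\mathcal{Z}\to[0,\infty)$ be measurable maps such that, writing $\Delta_\vartheta=\Delta(\vartheta,S)$, $V_\vartheta=V(\vartheta,S)$, the pair $(\Delta_\vartheta,\sqrt{V_\vartheta})$ is a canonical pair for every fixed $\vartheta\in\Theta$. Let $\hat p$ be a probability kernel from $\mathcal{Z}$ to $\Theta$, $p^0$ a probability measure on $\Theta$, and $\theta$ a random element of $\Theta$ whose conditional distribution given $S$ is $\hat p_S$; assume $\int|\Delta(\vartheta,S)|\,\hat p_S(d\vartheta)<\infty$ a.s. Then: (i) for every $y>0$, \[ \mathbb{E}\left[\frac{y}{\sqrt{y^2+\mathbb{E}[V_\theta\mid S]}}\exp\left(\frac{\mathbb{E}[\Delta_\theta\mid S]^2}{2(y^2+\mathbb{E}[V_\theta\mid S])}-\mathrm{KL}(\hat p_S\,\|\,p^0)\right)\right]\le 1; \] (ii) if moreover $0<\mathbb{E}[V_\theta]<\infty$, then for every $x\ge0$, \[ \mathbb{E}\left[\exp\left(x\sqrt{\left(\frac{\mathbb{E}[\Delta_\theta\mid S]^2}{\mathbb{E}[V_\theta]+\mathbb{E}[V_\theta\mid S]}-2\,\mathrm{KL}(\hat p_S\,\|\,p^0)\right)_+}\right)\right]\le 2e^{x^2}. \]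
   Context: A pair $(A,B)$ of real random variables is a canonical pair if $B\ge0$ and $\sup_{\lambda\in\mathbb{R}}\mathbb{E}[\exp(\lambda A-\lambda^2B^2/2)]\le1$. A probability kernel $\hat p$ from $\mathcal{Z}$ to $\Theta$ assigns to each $z$ a probability measure $\hat p_z$ on $\Theta$, measurably in $z$. Notation: $\mathbb{E}[\Delta_\theta\mid S]=\int\Delta(\vartheta,S)\,\hat p_S(d\vartheta)$, $\mathbb{E}[V_\theta\mid S]=\int V(\vartheta,S)\,\hat p_S(d\vartheta)$, $\mathbb{E}[V_\theta]=\mathbb{E}[\mathbb{E}[V_\theta\mid S]]$. $\mathrm{KL}(p\,\|\,q)=\int\ln\frac{dp}{dq}\,dp$ if $p\ll q$ and $+\infty$ otherwise, with conventions $e^{-\infty}=0$ and $(-\infty)_+=0$. $(s)_+=\max\{0,s\}$. *)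

(* Defs.v *)
From HB Require Import structures.
From mathcomp Require Import all_boot all_order all_algebra.
From mathcomp Require Import all_classical all_reals all_analysis.
From mathcomp Require Import measurable_realfun.
Set Implicit Arguments. Unset Strict Implicit. Unset Printing Implicit Defensive.
Import Order.TTheory GRing.Theory Num.Theory.
Import numFieldNormedType.Exports.
Local Open Scope classical_set_scope.
Local Open Scope ring_scope.

Section defs.
Context (R : realType).

Definition KL d (T : measurableType d) (p q : probability T R) : \bar R :=
  if asbool (p `<< q) then
    (\int[p]_x lne (Radon_Nikodym (charge_of_finite_measure p) q x))%E
  else +oo%E.

Definition canonical_pair d (Omega : measurableType d) (P : probability Omega R)
  (A B : Omega -> R) : Prop :=
  [/\ measurable_fun setT A, measurable_fun setT B,
      (forall w, 0 <= B w) &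
      forall lam : R,
        (\int[P]_w (expR (lam * A w - lam ^+ 2 * (B w) ^+ 2 / 2))%:E <= 1)%E].

Definition is_prob_kernel dZ dT (Z : measurableType dZ) (Theta : measurableType dT)
  (k : Z -> probability Theta R) : Prop :=
  forall A : set Theta, measurable A -> measurable_fun [set: Z] ((fun z => k z A) : Z -> \bar R).

Definition cond_distr dO dT dZ (Omega : measurableType dO)
  (Theta : measurableType dT) (Z : measurableType dZ)
  (P : probability Omega R) (th : Omega -> Theta) (S : Omega -> Z)
  (k : Z -> probability Theta R) : Prop :=
  forall (A : set Theta) (B : set Z), measurable A -> measurable B ->
    P (th @^-1` A `&` S @^-1` B) = (\int[P]_(w in S @^-1` B) k (S w) A)%E.

Definition condE dT dZ (Theta : measurableType dT) (Z : measurableType dZ)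
  (k : Z -> probability Theta R) (F : Theta * Z -> R) (z : Z) : \bar R :=
  (\int[k z]_t (F (t, z))%:E)%E.

(* integrand of (i), with the conventions 1/sqrt(+oo) = 0, e^{-oo} = 0:
   it is 0 as soon as E[V|S=z] = +oo or KL = +oo *)
Definition integrand_i dT dZ (Theta : measurableType dT) (Z : measurableType dZ)
  (k : Z -> probability Theta R) (p0 : probability Theta R)
  (Delta V : Theta * Z -> R) (y : R) (z : Z) : \bar R :=
  let d := fine (condE k Delta z) in
  match condE k V z, KL (k z) p0 with
  | v%:E, kl%:E =>
      (y / Num.sqrt (y ^+ 2 + v) *
       expR (d ^+ 2 / (2 * (y ^+ 2 + v)) - kl))%:E
  | _, _ => 0%E
  end.

(* integrand of (ii), conventions d^2/(+oo) = 0 and (-oo)_+ = 0: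
   it equals exp(x * sqrt 0) = 1 as soon as E[V|S=z] = +oo or KL = +oo *)
Definition integrand_ii dT dZ (Theta : measurableType dT) (Z : measurableType dZ)
  (k : Z -> probability Theta R) (p0 : probability Theta R)
  (Delta V : Theta * Z -> R) (EV x : R) (z : Z) : \bar R :=
  let d := fine (condE k Delta z) in
  match condE k V z, KL (k z) p0 with
  | v%:E, kl%:E =>
      (expR (x * Num.sqrt (Num.max 0 (d ^+ 2 / (EV + v) - 2 * kl))))%:E
  | _, _ => 1%E
  end.

End defs.

(* Main.v *)
(* For real l put h_l(t) = l Delta_t - l^2 V_t / 2. Gibbs' variational inequality gives
   exp (int h_l d(ph_S) - KL(ph_S || p0)) <= int exp (h_l) dp0. Integrating over
   l ~ N(0, 1/y^2), the left-hand side becomes the integrand of (i) and, by Tonelli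
   and the canonical pair property, the right-hand side has expectation at most 1.
   For (ii), apply (i) with y^2 = E[V], and let g be its integrand,
   D = 1 + E[V | S] / E[V] and W the expression whose positive part appears in (ii).
   Then exp (W / 2) = g sqrt D, x sqrt W <= x^2 + W / 4, and
   max 1 (g^(1/2) D^(1/4)) <= g / 2 + D / 4 + 3 / 4, whose expectation is at most
   1/2 + 2/4 + 3/4 < 2. *)
Require Import Defs.
From HB Require Import structures.
From mathcomp Require Import all_boot all_order all_algebra.
From mathcomp Require Import all_classical all_reals all_analysis.
From mathcomp Require Import measurable_realfun.
From mathcomp Require Import ring lra.
Import Order.TTheory GRing.Theory Num.Theory.
Local Open Scope classical_set_scope.
Local Open Scope ring_scope.
Set Implicit Arguments.
Unset Strict Implicit.

(** * Comparison and integrability of extended-real functions *)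

(* [f] need not be measurable: [KL (k z) p0] need not depend measurably on [z] when
   the sigma-algebra of [Theta] is not countably generated. The integral of a
   nonnegative [f] is then its lower integral. *)
Lemma ge0_le_lower_integral d (T : measurableType d) (R : realType)
    (mu : {measure set T -> \bar R}) (f g : T -> \bar R) :
  (forall x, (0 <= f x)%E) -> (forall x, (f x <= g x)%E) ->
  (\int[mu]_x f x <= \int[mu]_x g x)%E.
Proof.
move=> f0 fg; have g0 x : (0 <= g x)%E by exact: le_trans (fg x).
rewrite !ge0_integralTE//; apply: ereal_sup_le => _ [h hf <-].
by exists h => // x; exact: le_trans (fg x).
Qed.

(** Raising [g] to [+oo] on a measurable null set makes the inequality hold everywhere and leaves
    the integral of [g] unchanged; [f], possibly not measurable, is not modified. *)
Lemma ae_ge0_le_lower_integral d (T : measurableType d) (R : realType)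
    (mu : {measure set T -> \bar R}) (f g : T -> \bar R) :
  (forall x, (0 <= f x)%E) -> (forall x, (0 <= g x)%E) ->
  measurable_fun setT g -> {ae mu, forall x, (f x <= g x)%E} ->
  (\int[mu]_x f x <= \int[mu]_x g x)%E.
Proof.
move=> f0 g0 mg [N [mN N0 fgN]].
pose g' x := (if x \in N then +oo else g x)%E.
have mg' : measurable_fun setT g'.
  apply: measurable_fun_if => //.
  - apply: (measurable_fun_bool true); rewrite setTI.
    rewrite (_ : _ @^-1` _ = N)//.
    by apply/seteqP; split => x /=; [exact: set_mem|exact: mem_set].
  - exact: measurable_funTS.
have g'0 x : (0 <= g' x)%E by rewrite /g'; case: ifP.
apply: (@le_trans _ _ (\int[mu]_x g' x)%E).
  apply: ge0_le_lower_integral => // x; rewrite /g'; case: ifPn => [_|xN].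
    exact: leey.
  by apply: contrapT => /fgN /mem_set; rewrite (negbTE xN).
rewrite (@ge0_ae_eq_integral _ _ _ mu setT g' g)//.
exists N; split=> // x /=; apply: contra_notP => xN _.
by rewrite /g' ifF//; apply/negbTE; rewrite notin_setE.
Qed.

Lemma measurable_lne d (T : measurableType d) (R : realType) (f : T -> \bar R) :
  measurable_fun setT f -> measurable_fun setT (fun x => lne (f x)).
Proof.
move=> mf.
have -> : (fun x => lne (f x)) = (fun x => if (f x <= 0)%E then -oo%E else
    if (f x == +oo)%E then +oo%E else (ln (fine (f x)))%:E).
  apply/funext => x; by case: (f x) => [r| |] //=; rewrite leNye.
apply: measurable_fun_ifT => //; first exact: measurable_fun_lee.
apply: measurable_fun_ifT => //; first exact: measurable_fun_eqe.
apply/measurable_EFinP; apply: measurableT_comp; first exact: measurable_ln.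
exact: measurableT_comp.
Qed.

(** The integral is the difference of those of the positive and negative parts, and [+oo - +oo] is
    infinite by convention, so a finite value forces both to be finite. *)
Lemma fin_num_integral_integrable d (T : measurableType d) (R : realType)
    (mu : {measure set T -> \bar R}) (f : T -> \bar R) :
  measurable_fun setT f -> (\int[mu]_x f x)%E \is a fin_num ->
  mu.-integrable setT f.
Proof.
move=> mf; rewrite integralE => fin.
apply/integrableP; split => //.
rewrite -[fun x => _]/(abse \o f) fune_abse ge0_integralD//; last 2 first.
- exact: measurable_funepos.
- exact: measurable_funeneg.
have p0 : (0 <= \int[mu]_x f^\+ x)%E by exact: integral_ge0.
have n0 : (0 <= \int[mu]_x f^\- x)%E by exact: integral_ge0.
move: fin p0 n0; case: (\int[mu]_x f^\+ x)%E => [a| |]//;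
  by case: (\int[mu]_x f^\- x)%E => [b| |]// _ _ _; rewrite -EFinD ltry.
Qed.

(** * Gaussian integrals over the parameter [l] *)

(** Completing the square: [l d - m l^2 / 2 = d^2 / (2 m) - m (l - d / m)^2 / 2]. The factor
    [y / sqrt m] is the ratio of the normalizing constants. *)
Lemma normal_pdf_tilt (R : realType) (y v d l : R) : 0 < y -> 0 <= v ->
  let m := y ^+ 2 + v in
  normal_pdf 0 y^-1 l * expR (l * d - l ^+ 2 * v / 2) =
  y / Num.sqrt m * expR (d ^+ 2 / (2 * m)) *
    normal_pdf (d / m) (Num.sqrt m)^-1 l.
Proof.
move=> y0 v0 m.
have m0 : 0 < m by rewrite ltr_wpDr// exprn_gt0.
have s0 : 0 < Num.sqrt m by rewrite sqrtr_gt0.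
have s2 : Num.sqrt m ^+ 2 = m by rewrite sqr_sqrtr// ltW.
have y0' := lt0r_neq0 y0; have s0' := lt0r_neq0 s0; have m0' := lt0r_neq0 m0.
rewrite !normal_pdfE ?invr_eq0//.
have pk s : 0 < s -> normal_peak s^-1 = s * normal_peak (1 : R).
  move=> sp; rewrite /normal_peak !expr1n mul1r -mulrnAr sqrtrM ?sqr_ge0//.
  by rewrite sqrtr_sqr ger0_norm ?invr_ge0 ?ltW// invfM invrK.
rewrite !pk// /normal_fun.
transitivity (y * normal_peak 1 * (expR (d ^+ 2 / (2 * m)) *
   expR (- (l - d / m) ^+ 2 / ((Num.sqrt m)^-1 ^+ 2 *+ 2)))); last by field.
rewrite -[LHS]mulrA -!expRD; congr (_ * expR _).
by rewrite !exprVn s2; rewrite /m in m0' *; field; rewrite y0' m0'.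
Qed.

Lemma gaussian_mixture (R : realType) (y v d : R) : 0 < y -> 0 <= v ->
  (\int[@lebesgue_measure R]_l
     (normal_pdf 0 y^-1 l * expR (l * d - l ^+ 2 * v / 2))%:E =
   (y / Num.sqrt (y ^+ 2 + v) * expR (d ^+ 2 / (2 * (y ^+ 2 + v))))%:E)%E.
Proof.
move=> y0 v0; under eq_integral do rewrite normal_pdf_tilt// EFinM.
rewrite integralZl//; last exact: integrable_normal_pdf.
by rewrite integral_normal_pdf mule1.
Qed.

(** * Gibbs' variational inequality and its Gaussian mixture *)

Section gibbs.
Context d (T : measurableType d) (R : realType) (p q : probability T R).

(** A finite divergence gives a real-valued density [r] of [p] with respect to [q], nonnegative
    everywhere, with an integrable logarithm. *)
Lemma KL_density kl : KL p q = kl%:E -> exists r : T -> R,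
  [/\ measurable_fun setT r, (forall x, 0 <= r x),
      {ae p, forall x, 0 < r x},
      p.-integrable setT (fun x => (ln (r x))%:E) /\
      (\int[p]_x (ln (r x))%:E = kl%:E)%E &
      forall g : T -> R, measurable_fun setT g -> (forall x, 0 <= g x) ->
        (\int[p]_x (g x)%:E = \int[q]_x (g x * r x)%:E)%E].
Proof.
rewrite /KL; case: asboolP => // pq.
set rn := Radon_Nikodym _ _ => klE.
(* This version of the derivative is nonnegative and finite at every point. It agrees with [rn]
   almost everywhere for [q], hence for [p] because [p] is dominated by [q]. *)
pose f := Radon_Nikodym_SigmaFinite.f p q.
have f0 : forall x, (0 <= f x)%E by exact: Radon_Nikodym_SigmaFinite.f_ge0.
have ffin : forall x, f x \is a fin_num by exact: Radon_Nikodym_SigmaFinite.f_fin_num.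
have mf : measurable_fun setT f.
  by apply: measurable_int; exact: Radon_Nikodym_SigmaFinite.f_integrable.
have frn : ae_eq p setT f rn.
  apply: (null_dominates_ae_eq _ pq) => //.
  exact: ae_eq_Radon_Nikodym_SigmaFinite.
have mrn : measurable_fun setT rn.
  by apply: measurable_int; exact: Radon_Nikodym_integrable.
have mlf := measurable_lne mf.
have lfE : (\int[p]_x lne (f x) = kl%:E)%E.
  rewrite -klE; apply: ae_eq_integral => //; first exact: measurable_lne.
  by apply: filterS frn => x /= h /h ->.
have ilf : p.-integrable setT (fun x => lne (f x)).
  by apply: fin_num_integral_integrable => //; rewrite lfE.
(* Since [lne 0] is [-oo], integrability of [lne (f x)] rules out zeros of [f] up to a [p]-null
   set. *)
have f_gt0 : {ae p, forall x, 0 < fine (f x)}.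
  have := integrable_ae measurableT ilf.
  apply: filterS => x /(_ Logic.I); have := ffin x; have := f0 x.
  by case: (f x) => [r| |]//=; rewrite lee_fin; case: (ltgtP r 0).
have lnE : ae_eq p setT (fun x => lne (f x)) (fun x => (ln (fine (f x)))%:E).
  apply: filterS f_gt0 => x /= fx _; rewrite -(fineK (ffin x)) lne_EFin//.
have mlnf : measurable_fun setT (fun x => (ln (fine (f x)))%:E).
  apply/measurable_EFinP; apply: measurableT_comp; first exact: measurable_ln.
  exact: measurableT_comp.
have lnfE : (\int[p]_x (ln (fine (f x)))%:E = kl%:E)%E.
  by rewrite -lfE; apply/esym/ae_eq_integral.
exists (fine \o f); split => //.
- exact: measurableT_comp.
- by move=> x; rewrite fine_ge0.
- by split => //; apply: fin_num_integral_integrable => //; rewrite lnfE.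
- move=> g mg g0.
  rewrite -(Radon_Nikodym_SigmaFinite.change_of_variables pq)//; last first.
    exact/measurable_EFinP.
  by apply: eq_integral => x _; rewrite EFinM /= fineK.
Qed.

(** Change of measure, then Jensen: the [q]-integral of [exp h] is at least the [p]-integral of
    [exp h / r = exp (h - ln r)], and the exponent has [p]-mean [m]. *)
Lemma gibbs (h : T -> R) kl : KL p q = kl%:E ->
  p.-integrable setT (EFin \o h) ->
  ((expR (fine (\int[p]_x (h x)%:E) - kl))%:E <= \int[q]_x (expR (h x))%:E)%E.
Proof.
move=> /KL_density[r [mr r0 rgt0 [ilr lrE] rE]] ih.
have mh : measurable_fun setT h by apply/measurable_EFinP; exact: measurable_int ih.
set m := fine _ - kl.
pose e x := expR (h x - ln (r x)).
(* With this cut-off, [g r] equals [exp h] where [r > 0] and is 0 elsewhere, so it is at most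
   [exp h] everywhere. *)
pose g x := if 0 < r x then e x else 0.
have mlr : measurable_fun setT (fun x => ln (r x)).
  by apply/measurable_EFinP; exact: measurable_int ilr.
have g0 x : 0 <= g x by rewrite /g; case: ifP => // _; exact: expR_ge0.
have me : measurable_fun setT e.
  by apply: measurableT_comp => //; exact: measurable_funB.
have mg : measurable_fun setT g.
  by apply: measurable_fun_ifT => //; exact: measurable_fun_ltr.
have ihl : p.-integrable setT (fun x => (h x - ln (r x))%:E).
  by under eq_fun do rewrite EFinB; exact: integrableB.
have ihlE : (\int[p]_x (h x - ln (r x))%:E = m%:E)%E.
  under eq_integral do rewrite EFinB.
  rewrite integralB// lrE /m EFinB fineK//.
  exact: integrable_fin_num.
apply: (@le_trans _ _ (\int[p]_x (g x)%:E)%E); last first.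
  rewrite rE//; apply: ge0_le_integral => //.
  - by move=> x _; rewrite lee_fin mulr_ge0.
  - by apply/measurable_EFinP; exact: measurable_funM.
  - by apply/measurable_EFinP; exact: measurableT_comp.
  - move=> x _; rewrite lee_fin /g; case: ifPn => [rx|_].
      by rewrite /e expRB lnK ?posrE// divfK// gt_eqF.
    by rewrite mul0r expR_ge0.
have eg : (\int[p]_x (e x)%:E = \int[p]_x (g x)%:E)%E.
  apply: ge0_ae_eq_integral => //.
  - exact/measurable_EFinP.
  - exact/measurable_EFinP.
  - by move=> x _; rewrite lee_fin expR_ge0.
  - by move=> x _; rewrite lee_fin.
  - by apply: filterS rgt0 => x rx _; rewrite /g rx.
(* Jensen's inequality through the tangent line of [expR] at [m] *)
pose t x := expR m * (1 - m) + expR m * (h x - ln (r x)).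
have mt : measurable_fun setT (EFin \o t).
  apply/measurable_EFinP; apply: measurable_funD => //.
  by apply: measurable_funM => //; exact: measurable_funB.
have tE : (\int[p]_x (t x)%:E = (expR m)%:E)%E.
  rewrite /t; under eq_integral do rewrite EFinD (EFinM _ (h _ - _)).
  rewrite integralD//; last 2 first.
  - exact: finite_measure_integrable_cst.
  - exact: integrableZl.
  rewrite integralZl// ihlE (integral_cst p)//= probability_setT mule1.
  by rewrite -EFinM -EFinD; congr EFin; ring.
(* The tangent [t] may be negative, so the comparison goes through its positive part, which the
   nonnegative [e] also dominates. *)
rewrite -tE -eg integralE; apply: (@le_trans _ _ (\int[p]_x (EFin \o t)^\+ x)%E).
  by rewrite -[leRHS]adde0 leeD2l// oppe_le0; exact: integral_ge0.
apply: ge0_le_integral => //.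
- exact: measurable_funepos.
- exact/measurable_EFinP.
- move=> x _; rewrite funeposE ge_max !lee_fin expR_ge0 andbT /e /t.
  have := expR_ge1Dx (h x - ln (r x) - m).
  rewrite -(ler_pM2l (expR_gt0 m)) -expRD; rewrite [m + _]addrC subrK.
  by apply: le_trans; rewrite !mulrDr mulrN mulrN; lra.
Qed.
End gibbs.

Lemma KL_mixture d (T : measurableType d) (R : realType)
    (p q : probability T R) (a v : T -> R) (kl y : R) :
  0 < y -> (forall t, 0 <= v t) -> KL p q = kl%:E ->
  p.-integrable setT (EFin \o a) -> p.-integrable setT (EFin \o v) ->
  let av := fine (\int[p]_t (a t)%:E) in
  let vv := fine (\int[p]_t (v t)%:E) in
  ((y / Num.sqrt (y ^+ 2 + vv) *
      expR (av ^+ 2 / (2 * (y ^+ 2 + vv)) - kl))%:E <=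
   \int[@lebesgue_measure R]_l \int[q]_t
     (normal_pdf 0 y^-1 l * expR (l * a t - l ^+ 2 * v t / 2))%:E)%E.
Proof.
move=> y0 v0 klE ia iv; lazy zeta.
set av := fine (\int[p]_t (a t)%:E); set vv := fine (\int[p]_t (v t)%:E).
have vv0 : 0 <= vv by rewrite fine_ge0// integral_ge0// => t _; rewrite lee_fin.
have ma : measurable_fun setT a by apply/measurable_EFinP; exact: measurable_int ia.
have mv : measurable_fun setT v by apply/measurable_EFinP; exact: measurable_int iv.
(* With the left-hand side written as [exp (- kl)] times a Gaussian integral, it suffices to compare
   integrands at each [l], where [gibbs] applies to [l a - l^2 v / 2]. *)
rewrite expRD mulrA EFinM -gaussian_mixture// muleC.
have mtilt : measurable_fun [set: measurableTypeR R] (fun l : measurableTypeR R =>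
    (normal_pdf 0 y^-1 l * expR (l * av - l ^+ 2 * vv / 2))%:E).
  apply/measurable_EFinP; apply: measurable_funM; first exact: measurable_normal_pdf.
  apply: measurableT_comp => //; apply: measurable_funB.
    exact: measurable_funM.
  by do 2 (apply: measurable_funM => //).
rewrite -ge0_integralZl//; last first.
  by move=> l _; rewrite lee_fin mulr_ge0 ?normal_pdf_ge0 ?expR_ge0.
apply: ge0_le_lower_integral => l.
  by rewrite -EFinM lee_fin !mulr_ge0 ?normal_pdf_ge0 ?expR_ge0.
have ih : p.-integrable setT (EFin \o (fun t => l * a t - l ^+ 2 / 2 * v t)).
  rewrite (_ : _ \o _ = (fun t => l%:E * (a t)%:E - (l ^+ 2 / 2)%:E * (v t)%:E)%E)//.
  by apply: integrableB => //; exact: integrableZl.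
have := gibbs klE ih.
have -> : (\int[p]_t (l * a t - l ^+ 2 / 2 * v t)%:E = (l * av - l ^+ 2 / 2 * vv)%:E)%E.
  rewrite (eq_integral (fun t => l%:E * (a t)%:E - (l ^+ 2 / 2)%:E * (v t)%:E)%E)//.
  rewrite integralB//; [|exact: integrableZl..].
  by rewrite !integralZl// EFinB !EFinM /av /vv !fineK//; exact: integrable_fin_num.
rewrite /= => gi.
under eq_integral do rewrite EFinM.
rewrite ge0_integralZl//; last 2 first.
- apply/measurable_EFinP; apply: measurableT_comp => //; apply: measurable_funB.
    exact: measurable_funM.
  by do 2 (apply: measurable_funM => //).
- by rewrite lee_fin normal_pdf_ge0.
rewrite -EFinM mulrCA EFinM; apply: lee_wpmul2l; first by rewrite lee_fin normal_pdf_ge0.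
under eq_integral do rewrite mulrAC.
by rewrite -expRD addrC mulrAC.
Qed.

(** * Expectation of the mixture under the canonical pair property *)

Section canonical_mixture.
Context dT dO (T : measurableType dT) (Omega : measurableType dO) (R : realType).
Context (P : probability Omega R) (q : probability T R) (a v : T * Omega -> R) (y : R).
Hypotheses (ma : measurable_fun setT a) (mv : measurable_fun setT v).

(** The upper bound of [KL_mixture] at the sample point [w]. It involves only the prior [q], so it
    is measurable in [w] and can stand in for the integrand of (i). *)
Definition mixture w : \bar R :=
  (\int[@lebesgue_measure R]_l \int[q]_t
     (normal_pdf 0 y^-1 l * expR (l * a (t, w) - l ^+ 2 * v (t, w) / 2))%:E)%E.

Lemma mixture_ge0 w : (0 <= mixture w)%E.
Proof.
apply: integral_ge0 => l _; apply: integral_ge0 => t _.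
by rewrite lee_fin mulr_ge0 ?normal_pdf_ge0 ?expR_ge0.
Qed.

(** The variables are grouped so that Tonelli integrates out [T] first and the real parameter
    next. *)
Let f (x : (Omega * measurableTypeR R) * T) : \bar R :=
  (normal_pdf 0 y^-1 x.1.2 * expR (x.1.2 * a (x.2, x.1.1) - x.1.2 ^+ 2 * v (x.2, x.1.1) / 2))%:E.

Let f_ge0 x : (0 <= f x)%E.
Proof. by rewrite lee_fin mulr_ge0 ?normal_pdf_ge0 ?expR_ge0. Qed.

Let mf : measurable_fun setT f.
Proof.
have ml : measurable_fun setT (fun x : (Omega * measurableTypeR R) * T => x.1.2 : R).
  exact: (measurableT_comp measurable_snd measurable_fst).
have mx : measurable_fun setT (fun x : (Omega * measurableTypeR R) * T => (x.2, x.1.1)).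
  apply: measurable_fun_pair => //.
  exact: (measurableT_comp measurable_fst measurable_fst).
apply/measurable_EFinP; apply: measurable_funM.
  by apply: measurableT_comp ml; exact: measurable_normal_pdf.
apply: measurableT_comp => //; apply: measurable_funB.
  by apply: measurable_funM => //; exact: measurableT_comp mx.
apply: measurable_funM => //; apply: measurable_funM => //.
  exact: measurable_funX.
exact: measurableT_comp mx.
Qed.

Let F (x : Omega * measurableTypeR R) : \bar R := (\int[q]_t f (x, t))%E.

Let mF : measurable_fun setT F.
Proof. exact: measurable_fun_fubini_tonelli_F. Qed.

Let F_ge0 x : (0 <= F x)%E.
Proof. exact: integral_ge0. Qed.

Lemma measurable_mixture : measurable_fun setT mixture.
Proof. exact: (measurable_fun_fubini_tonelli_F (m2 := @lebesgue_measure R) F). Qed.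

Lemma integral_mixture_le1 :
  (forall t l, \int[P]_w (expR (l * a (t, w) - l ^+ 2 * v (t, w) / 2))%:E <= 1)%E ->
  (\int[P]_w mixture w <= 1)%E.
Proof.
move=> av1.
rewrite (_ : \int[P]_w _ = \int[P]_w \int[@lebesgue_measure R]_l F (w, l))%E//.
rewrite (fubini_tonelli (m1 := P) (m2 := @lebesgue_measure R) F)//.
(* The bound 1 is the total mass of the Gaussian; it remains to bound the integrand by the density
   at each [l]. *)
rewrite -(integral_normal_pdf 0 y^-1); apply: ge0_le_lower_integral => l.
  exact: integral_ge0.
rewrite (fubini_tonelli (m1 := P) (m2 := q) (fun x => f (x.1, l, x.2)))//; last first.
  apply: measurableT_comp mf _; apply: measurable_fun_pair => //.
  exact: measurable_fun_pair.
(* The density at [l] is now spread over [q], of mass 1, which reduces the bound to fixed [t] and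
   [l]. *)
rewrite -[leRHS]mule1 -(@probability_setT _ _ _ q) -[X in (_ <= X)%E]integral_cst//.
apply: ge0_le_lower_integral => t; first exact: integral_ge0.
rewrite /f/=; under eq_integral do rewrite EFinM.
rewrite ge0_integralZl//.
- by rewrite -[leRHS]mule1; apply: lee_wpmul2l; rewrite ?lee_fin ?normal_pdf_ge0.
- apply/measurable_EFinP; apply: measurableT_comp => //; apply: measurable_funB.
    by apply: measurable_funM => //; exact: measurableT_comp ma _.
  do 2 (apply: measurable_funM => //).
  exact: measurableT_comp mv _.
- by rewrite lee_fin normal_pdf_ge0.
Qed.
End canonical_mixture.

(** * The pointwise inequality behind (ii) *)

Lemma expR_sqrt_le (R : realType) (x D g W : R) :
  0 <= x -> 1 <= D -> 0 <= g -> expR (W / 2) <= g * Num.sqrt D ->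
  expR (x * Num.sqrt (Num.max 0 W)) <= expR (x ^+ 2) * (g / 2 + D / 4 + 3 / 4).
Proof.
move=> x0 D1 g0 Wg.
(* For [W <= 0] the left-hand side is 1; this case dictates the constant [3 / 4], since [D / 4] is
   only known to be at least [1 / 4]. *)
have [W0|W0] := leP W 0.
  rewrite sqrtr0 mulr0 expR0 -[leLHS]mulr1; apply: ler_pM => //.
    by rewrite -[leLHS]expR0 ler_expR sqr_ge0.
  by lra.
have s2 : Num.sqrt W ^+ 2 = W by rewrite sqr_sqrtr// ltW.
apply: (@le_trans _ _ (expR (x ^+ 2 + W / 4))).
  rewrite ler_expR -[X in _ + X / 4]s2; have := sqr_ge0 (x - Num.sqrt W / 2); nra.
rewrite expRD ler_pM2l ?expR_gt0//.
have e2 : expR (W / 4) ^+ 2 = expR (W / 2).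
  by rewrite -expRM_natl; congr expR; field.
have := Num.Theory.sqrtr_ge0 D; have : Num.sqrt D ^+ 2 = D by rewrite sqr_sqrtr//; lra.
move: (expR_ge0 (W / 4)) e2 Wg; set e := expR (W / 4); set E := expR _; set s := Num.sqrt D.
move=> e0 <- Wg sD s0.
(* Arithmetic-geometric mean: [e^2 <= g s]. Afterwards [s <= (1 + D) / 2] removes the square
   root. *)
have eg : e <= (g + s) / 2.
  rewrite -ler_sqr ?nnegrE ?divr_ge0 ?addr_ge0//; have := sqr_ge0 (g - s); nra.
have := sqr_ge0 (s - 1); nra.
Qed.

(** * Measurability of conditional expectations *)

Section prob_kernel.
Context dT dZ (T : measurableType dT) (Z : measurableType dZ) (R : realType).
Context (k : Z -> probability T R) (hk : is_prob_kernel k).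

(** A copy of [k] with values in measures, to which the kernel structures are attached. *)
Let ker (z : Z) : {measure set T -> \bar R} := k z.

Let measurable_ker U : measurable U -> measurable_fun [set: Z] (ker ^~ U).
Proof. exact: hk. Qed.

HB.instance Definition _ := isKernel.Build _ _ _ _ _ ker measurable_ker.

Let ker_prob z : ker z [set: T] = 1%E.
Proof. exact: probability_setT. Qed.

HB.instance Definition _ := Kernel_isProbability.Build _ _ _ _ _ ker ker_prob.

Lemma measurable_condE (F : T * Z -> R) : (forall x, 0 <= F x) ->
  measurable_fun setT F -> measurable_fun setT (condE k F).
Proof.
move=> F0 mF.
apply: (measurable_fun_integral_finite_kernel (fun x => (F (x.2, x.1))%:E) ker).
  by move=> x; rewrite lee_fin.
apply/measurable_EFinP; apply: measurableT_comp mF _.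
exact: measurable_fun_pair.
Qed.

End prob_kernel.

(** * The two exponential bounds *)

Unset Implicit Arguments.
Set Strict Implicit.

Theorem theorem4 (R : realType) (dT dZ dO : measure_display)
  (Theta : measurableType dT) (Z : measurableType dZ)
  (Omega : measurableType dO) (P : probability Omega R)
  (S : Omega -> Z) (mS : measurable_fun setT S)
  (Delta V : Theta * Z -> R)
  (mDelta : measurable_fun setT Delta) (mV : measurable_fun setT V)
  (V_ge0 : forall q, 0 <= V q)
  (hcan : forall t : Theta, canonical_pair P (fun w => Delta (t, S w))
                                          (fun w => Num.sqrt (V (t, S w))))
  (ph : Z -> probability Theta R) (hph : is_prob_kernel ph)
  (p0 : probability Theta R)
  (th : Omega -> Theta) (mth : measurable_fun setT th)
  (hth : cond_distr P th S ph)
  (hint : {ae P, forall w, (\int[ph (S w)]_t `|(Delta (t, S w))%:E| < +oo)%E}) :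
  (forall y : R, 0 < y ->
     (\int[P]_w integrand_i ph p0 Delta V y (S w) <= 1)%E) /\
  (let EV := (\int[P]_w condE ph V (S w))%E in
   (0 < EV < +oo)%E ->
   forall x : R, 0 <= x ->
     (\int[P]_w integrand_ii ph p0 Delta V (fine EV) x (S w)
        <= (2 * expR (x ^+ 2))%:E)%E).
Proof.
pose a (u : Theta * Omega) := Delta (u.1, S u.2).
pose v (u : Theta * Omega) := V (u.1, S u.2).
have mS2 : measurable_fun setT (fun u : Theta * Omega => (u.1, S u.2)).
  by apply: measurable_fun_pair => //; exact: measurableT_comp.
have ma : measurable_fun setT a by exact: measurableT_comp mDelta mS2.
have mv : measurable_fun setT v by exact: measurableT_comp mV mS2.
have mixle1 y : (\int[P]_w mixture p0 a v y w <= 1)%E.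
  apply: integral_mixture_le1 => // t l.
  have [_ _ _ /(_ l)] := hcan t.
  by under eq_integral do rewrite sqr_sqrtr//.
have mmix y := measurable_mixture p0 y ma mv.
have condV0 z : (0 <= condE ph V z)%E.
  by apply: integral_ge0 => t _; rewrite lee_fin.
have i0 y w : 0 < y -> (0 <= integrand_i ph p0 Delta V y (S w))%E.
  move=> y0; rewrite /integrand_i.
  case: (condE ph V _) (condV0 (S w)) => [vv| |]//.
  rewrite lee_fin => vv0; case: (KL _ _) => // kl; rewrite lee_fin.
  by rewrite mulr_ge0 ?expR_ge0// divr_ge0 ?sqrtr_ge0// ltW.
(* If the conditional mean of [V] or the divergence is infinite, the integrand is 0 by convention;
   otherwise [KL_mixture] applies to [ph (S w)]. *)
have imix y w : 0 < y -> (\int[ph (S w)]_t `|(Delta (t, S w))%:E| < +oo)%E ->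
    (integrand_i ph p0 Delta V y (S w) <= mixture p0 a v y w)%E.
  move=> y0 iDelta; rewrite /integrand_i.
  case vE : (condE ph V _) => [vv| |]; rewrite ?mixture_ge0//.
  case klE : (KL _ _) => [kl| |]; rewrite ?mixture_ge0//.
  have ia : (ph (S w)).-integrable setT (EFin \o (fun t => Delta (t, S w))).
    apply/integrableP; split => //.
    by apply/measurable_EFinP; exact: measurableT_comp mDelta _.
  have iv : (ph (S w)).-integrable setT (EFin \o (fun t => V (t, S w))).
    apply: fin_num_integral_integrable; last by rewrite /condE in vE; rewrite vE.
    by apply/measurable_EFinP; exact: measurableT_comp mV _.
  have := KL_mixture y0 (fun t => V_ge0 (t, S w)) klE ia iv.
  by rewrite /condE in vE *; rewrite vE.
split=> [y y0|EV /andP[EV0 EVoo] x x0].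
  apply: le_trans (mixle1 y); apply: ae_ge0_le_lower_integral => //.
  - by move=> w; exact: i0.
  - by move=> w; exact: mixture_ge0.
  - by apply: filterS hint => w; exact: imix.
have EVfin : EV \is a fin_num by rewrite ge0_fin_numE// ltW.
have E0 : 0 < fine EV by rewrite fine_gt0// EV0.
set E := fine EV; have EE : EV = E%:E by rewrite fineK.
(* This choice turns the denominator [y^2 + v] of (i) into the denominator [E + v] of (ii). *)
pose y := Num.sqrt E.
have y0 : 0 < y by rewrite sqrtr_gt0.
have y2 : y ^+ 2 = E by rewrite sqr_sqrtr// ltW.
have mcV : measurable_fun setT (fun w => condE ph V (S w)).
  exact: (measurableT_comp (measurable_condE hph V_ge0 mV) mS).
(* The bound of [expR_sqrt_le] with [g] replaced by the mixture and [D = 1 + v / E], so that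
   [D / 4 + 3 / 4 = v / (4 E) + 1]. *)
pose H w := ((expR (x ^+ 2))%:E * (2^-1%:E * mixture p0 a v y w +
  ((4 * E)^-1%:E * condE ph V (S w) + 1)))%E.
have E4 : (0 <= (4 * E)^-1)%R by rewrite invr_ge0 mulr_ge0// ltW.
have cge0 w : (0 <= (4 * E)^-1%:E * condE ph V (S w))%E by exact: mule_ge0.
have mge0 w : (0 <= 2^-1%:E * mixture p0 a v y w)%E.
  by rewrite mule_ge0 ?lee_fin ?mixture_ge0.
(* This covers the points where [integrand_ii] takes its default value 1. *)
have H1 w : (1 <= H w)%E.
  rewrite /H -[leLHS]mule1; apply: lee_pmul => //.
    by rewrite lee_fin -expR0 ler_expR sqr_ge0.
  by rewrite addeA leeDr// adde_ge0.
have mH1 : measurable_fun setT (fun w => (4 * E)^-1%:E * condE ph V (S w))%E.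
  exact: measurable_funeM.
have mH2 : measurable_fun setT (fun w => 2^-1%:E * mixture p0 a v y w)%E.
  exact: measurable_funeM.
have mH3 : measurable_fun setT (fun w => (4 * E)^-1%:E * condE ph V (S w) + 1)%E.
  exact: emeasurable_funD.
have mH4 : measurable_fun setT (fun w => 2^-1%:E * mixture p0 a v y w +
  ((4 * E)^-1%:E * condE ph V (S w) + 1))%E.
  exact: emeasurable_funD.
have H40 w : (0 <= 2^-1%:E * mixture p0 a v y w +
  ((4 * E)^-1%:E * condE ph V (S w) + 1))%E.
  by rewrite adde_ge0// adde_ge0.
(* The expectation of [H] is at most [(1 / 2 + 1 / 4 + 1) exp (x^2)], and [7 / 4 <= 2]. *)
apply: (@le_trans _ _ (\int[P]_w H w)%E); last first.
  rewrite ge0_integralZl//.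
  rewrite ge0_integralD//; last by move=> w _; rewrite adde_ge0.
  rewrite ge0_integralD// !ge0_integralZl//; last by move=> w _; exact: mixture_ge0.
  rewrite (integral_cst P)//= probability_setT mule1 -/EV EE.
  have mfin : (\int[P]_w mixture p0 a v y w \is a fin_num)%E.
    rewrite ge0_fin_numE; first exact: le_lt_trans (mixle1 y) (ltry _).
    by apply: integral_ge0 => w _; exact: mixture_ge0.
  have := mixle1 y; rewrite -(fineK mfin) lee_fin => m1.
  rewrite [leLHS](_ : _ = (expR (x ^+ 2) *
    (2^-1 * fine (\int[P]_w mixture p0 a v y w) + ((4 * E)^-1 * E + 1)))%:E)//.
  rewrite lee_fin.
  rewrite [leRHS]mulrC ler_pM2l ?expR_gt0//.
  have -> : (4 * E)^-1 * E = 4^-1 by field; rewrite gt_eqF.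
  lra.
apply: ae_ge0_le_lower_integral.
- move=> w; rewrite /integrand_ii; case: (condE ph V _) => // vv.
  by case: (KL _ _) => // kl; rewrite lee_fin expR_ge0.
- by move=> w; exact: le_trans (H1 w).
- exact: measurable_funeM.
- apply: filterS hint => w /(imix _ _ y0); move: (H1 w).
  rewrite /H /integrand_i /integrand_ii.
  case: (condE ph V _) (condV0 (S w)) => [vv| |]//.
  case: (KL _ _) => [kl| |]//; rewrite lee_fin => vv0 _ mix.
  set d := fine _ in mix *; set g := (y / _ * _) in mix; set W := (_ - 2 * kl).
  have g0 : 0 <= g by rewrite mulr_ge0 ?expR_ge0// divr_ge0 ?sqrtr_ge0// ltW.
  have Ev0 : 0 < E + vv by rewrite ltr_wpDr.
  have sEv0 : Num.sqrt (E + vv) != 0 by rewrite gt_eqF// sqrtr_gt0.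
  have D1 : 1 <= (E + vv) / E by rewrite ler_pdivlMr// mul1r lerDl.
  (* In fact an equality: [sqrt D] cancels the prefactor [y / sqrt (E + vv)] of [g]. *)
  have Wg : expR (W / 2) <= g * Num.sqrt ((E + vv) / E).
    rewrite /g y2 (sqrtrM _ (ltW Ev0)) (sqrtrV (ltW E0)) -/y.
    rewrite (_ : W / 2 = d ^+ 2 / (2 * (E + vv)) - kl); last first.
      by rewrite /W; field; rewrite gt_eqF.
    rewrite le_eqVlt; apply/orP; left; apply/eqP.
    by field; rewrite sEv0 gt_eqF.
  apply: (@le_trans _ _ (expR (x ^+ 2) * (g / 2 + (E + vv) / E / 4 + 3 / 4))%:E).
    by rewrite lee_fin expR_sqrt_le.
  rewrite EFinM; apply: lee_wpmul2l; first by rewrite lee_fin expR_ge0.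
  rewrite (_ : g / 2 + _ + _ = 2^-1 * g + ((4 * E)^-1 * vv + 1)); last first.
    by field; rewrite gt_eqF.
  by rewrite EFinD EFinM; apply: leeD => //; apply: lee_wpmul2l; rewrite ?lee_fin.
Qed.
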